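(* Let $\pi$ be a probability density on $\mathbb{R}^p$ that is continuous at $\theta_0$ with $\pi(\theta_0)>0$. For each $n$ let $f_n:\mathbb{R}^p\to\mathbb{R}$ be measurable with $z_n:=\int e^{f_n(\theta)}\pi(\theta)\,d\theta<\infty$, let $\pi_n(\theta)=e^{f_n(\theta)}\pi(\theta)/z_n$, let $\theta_n\to\theta_0$, and let $q_n(x)=n^{-p/2}\pi_n(\theta_n+x/\sqrt n)$ be the density of $\sqrt n(\theta-\theta_n)$ when $\theta\sim\pi_n$. Assume: (C1) there are symmetric matrices $H_n\to H_0$ with $H_0$ positive definite and functions $r_n$ such that $f_n(\theta)=f_n(\theta_n)-\frac n2(\theta-\theta_n)^\top H_n(\theta-\theta_n)+r_n(\theta)$ for all $\theta$; for every fixed $x\in\mathbb{R}^p$, $r_n(\theta_n+x/\sqrt n)-r_n(\theta_n)\to0$; and there exist $\varepsilon_0>0$, $c_0\ge0$, vectors $c_n\to0$ and reals $d_n$ with $\limsup_n d_n<\infty$ such that for all $n$ and all $x$ with $\|x\|<\varepsilon_0\sqrt n$, $r_n(\theta_n+x/\sqrt n)-r_n(\theta_n)\le c_0\|x\|^3/\sqrt n+x^\top c_n+d_n$; (C2) for every $\varepsilon\in(0,\varepsilon_0)$, $\liminf_{n\to\infty}\inf_{\|\theta-\theta_n\|\ge\varepsilon}\frac{f_n(\theta_n)-f_n(\theta)}{n}>0$. Then $\int_{\mathbb{R}^p}|q_n(x)-\phi(x)|\,dx\to0$, where $\phi$ is the density of $\mathcal{N}_p(0,H_0^{-1})$. 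*)

(* Defs.v *)
From HB Require Import structures.
From mathcomp Require Import all_boot all_order all_algebra.
From mathcomp Require Import all_classical all_reals all_analysis.

Set Implicit Arguments.
Unset Strict Implicit.
Unset Printing Implicit Defensive.

Import Order.TTheory GRing.Theory Num.Theory.
Import numFieldNormedType.Exports.
Local Open Scope classical_set_scope.
Local Open Scope ring_scope.

Definition enorm (R : realType) (p : nat) (x : 'rV[R]_p) : R :=
  Num.sqrt (\sum_(i < p) x ord0 i ^+ 2).

Definition qform (R : realType) (p : nat) (H : 'M[R]_p) (x : 'rV[R]_p) : R :=
  (x *m H *m x^T) ord0 ord0.

Definition dotv (R : realType) (p : nat) (x y : 'rV[R]_p) : R :=
  (x *m y^T) ord0 ord0.

Definition symmetric_mx (R : realType) (p : nat) (H : 'M[R]_p) : Prop :=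
  H^T = H.

Definition posdef_mx (R : realType) (p : nat) (H : 'M[R]_p) : Prop :=
  symmetric_mx H /\ forall x : 'rV[R]_p, x != 0 -> 0 < qform H x.

Definition borel_rV (R : realType) (p : nat) : set (set 'rV[R]_p) :=
  <<s [set A : set 'rV[R]_p | open A] >>.

Definition rV_measurable_fun (R : realType) (p : nat) (f : 'rV[R]_p -> R) : Prop :=
  forall B : set R, measurable B -> @borel_rV R p (f @^-1` B).

(* Lebesgue integral over R^p of an extended-real valued function, computed as
   the iterated one-dimensional Lebesgue integral (by Tonelli, this equals the
   integral w.r.t. p-dimensional Lebesgue measure for nonnegative Borel
   functions, the only case in which it is used). *)
Fixpoint iint (R : realType) (p : nat) : ('rV[R]_p -> \bar R) -> \bar R :=
  match p return ('rV[R]_p -> \bar R) -> \bar R with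
  | 0 => fun f => f 0
  | p'.+1 => fun f =>
      (\int[@lebesgue_measure R]_(x in [set: R])
          iint (fun v : 'rV[R]_p' => f (row_mx (\row_(j < 1) x) v)))%E
  end.

Definition gauss_density (R : realType) (p : nat) (H0 : 'M[R]_p) (x : 'rV[R]_p) : R :=
  ((Num.sqrt (2 * pi)) ^+ p)^-1 * Num.sqrt (\det H0) * expR (- (qform H0 x) / 2).

Definition prob_density (R : realType) (p : nat) (pi0 : 'rV[R]_p -> R) : Prop :=
  rV_measurable_fun pi0 /\ (forall t, 0 <= pi0 t) /\ iint (fun t => (pi0 t)%:E) = 1%E.

(* Main.v *)
Require Import Defs.
From HB Require Import structures.
From mathcomp Require Import all_boot all_order all_algebra.
From mathcomp Require Import all_classical all_reals all_analysis.
From mathcomp Require Import measurable_realfun ring lra.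
Import Order.TTheory GRing.Theory Num.Theory.
Import numFieldNormedType.Exports.
Local Open Scope classical_set_scope.
Local Open Scope ring_scope.

(** Put [g_n x = exp (f_n t - f_n theta_n) * pi t] with
    [t = theta_n + x / sqrt n]. By (C1), [g_n] converges pointwise to
    [g x = pi theta_0 * exp (- x^T H_0 x / 2)], and on [|x| < delta sqrt n], with
    [delta] small, the cubic term is at most a small multiple of [|x|^2], so
    that [g_n] is dominated by a fixed Gaussian. On the complement, (C2) bounds
    the integral of [g_n] by [n^(p/2) exp (- eta n)]. Hence [g_n] tends to [g]
    in L^1, and so do the normalized functions, which are [q_n] and the Gaussian
    density. The iterated integral is an integral against a sigma-finite Borel
    measure, built by induction on the dimension; the Gaussian integral follows
    the same induction, each step completing the square with a Schur
    complement. *)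

Set Implicit Arguments.
Unset Strict Implicit.
Unset Printing Implicit Defensive.

(** * Lebesgue measure on row vectors *)

(** A copy of the row vectors carrying the sigma-algebra of [borel_rV], so that general measure
    theory applies to them. *)
Notation rVb R p := (g_sigma_algebraType [set A : set 'rV[R]_p | open A]).

Section borel_row_vectors.
Context {R : realType}.

Lemma continuous_measurable_rV p m (h : 'rV[R]_p -> 'rV[R]_m) :
  continuous h -> measurable_fun setT (h : rVb R p -> rVb R m).
Proof.
move=> ch; apply: measurability => //.
move=> _ [B oB <-]; rewrite setTI.
by apply: sub_sigma_algebra; apply: open_comp => // x _; exact: ch.
Qed.

Lemma continuous_measurable_rVR p (h : 'rV[R]_p -> R) :
  continuous h -> measurable_fun setT (h : rVb R p -> R).
Proof.
move=> ch; apply: (@measurability _ _ _ _ _ _ (@measurable_realfun.RGenOpens.G R)).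
  exact: measurable_realfun.RGenOpens.measurableE.
move=> _ [B [a [b ->]] <-]; rewrite setTI.
apply: sub_sigma_algebra; apply: open_comp => [x _|]; [exact: ch|exact: interval_open].
Qed.

Lemma measurable_affine_rV p (a : 'rV[R]_p) (s : R) : measurable_fun [set: rVb R p]
  ((fun x : 'rV[R]_p => a + s *: x) : rVb R p -> rVb R p).
Proof.
apply: continuous_measurable_rV => x.
by apply: continuousD; [exact: cst_continuous|apply: continuousZr; exact: cvg_id].
Qed.

Lemma mx_ratr_near p (x : 'rV[R]_p) (e : R) : 0 < e ->
  exists v : 'rV[rat]_p, ball x e (map_mx ratr v).
Proof.
move=> e0.
have h (i : 'I_p) : {q : rat | `|x ord0 i - ratr q| < e}.
  apply: cid; have [q] := @rat_in_itvoo R (x ord0 i - e) (x ord0 i + e) ltac:(lra).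
  rewrite in_itv/= => /andP[q1 q2]; exists q; rewrite ltr_norml; lra.
exists (\row_i sval (h i)); split=> // i j.
by rewrite !mxE ord1 /ball_/=; case: (h j).
Qed.

(** An open set is a countable union of balls with rational centre and radius 1/(n+1), by
    [mx_ratr_near]. In the sup norm each such ball is a finite intersection of conditions on single
    coordinates, and these have measurable preimages. *)
Lemma measurable_fun_rV d (T : measurableType d) p (G : T -> 'rV[R]_p) :
  (forall i, measurable_fun setT (fun t => G t ord0 i)) ->
  measurable_fun setT (G : T -> rVb R p).
Proof.
move=> mG; apply: measurability => //.
move=> _ [B oB <-]; rewrite setTI.
pose K := ('rV[rat]_p * nat)%type.
pose bx (k : K) : set 'rV[R]_p := ball (map_mx (@ratr R) k.1 : 'rV[R]_p) (k.2.+1%:R^-1).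
have -> : B = \bigcup_(k in [set k : K | bx k `<=` B]) bx k.
  apply/seteqP; split => [x Bx|x [k kB]]; last exact: kB.
  have /nbhs_ballP[e /= e0 eB] : nbhs (x : 'rV[R]_p) B by exact: open_nbhs_nbhs.
  have [n ne] : exists n : nat, n.+1%:R^-1 < e / 2.
    have e20 : 0 < e / 2 by rewrite divr_gt0.
    by have [n] := ltr_add_invr e20; rewrite add0r => ?; exists n.
  have [v xv] := @mx_ratr_near p x n.+1%:R^-1 (ltac:(by [])).
  exists (v, n); last exact/ball_sym.
  move=> y /= vy; apply: eB.
  apply: (@le_ball _ _ _ (n.+1%:R^-1 + n.+1%:R^-1)); first by rewrite [leRHS]splitr lerD// ltW.
  exact: ball_triangle xv vy.
rewrite preimage_bigcup bigcup_mkcond.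
apply: countable_bigcupT_measurable => [|k]; first exact: countableP.
case: ifPn => // _.
have -> : G @^-1` bx k = \bigcap_(i in [set: 'I_p])
    (fun t => G t ord0 i) @^-1` ball (ratr (k.1 ord0 i) : R) k.2.+1%:R^-1.
  apply/seteqP; split=> [t [_ h] i _ | t h]; first by have := h ord0 i; rewrite mxE.
  by split => // i j; rewrite ord1 mxE; exact: h.
apply: fin_bigcap_measurable => // i _.
by rewrite -[X in measurable X]setTI; apply: mG; rewrite // ball_itv; exact: measurable_itv.
Qed.

End borel_row_vectors.

Section lebesgue_rV.
Context {R : realType}.
Implicit Type p : nat.

(** Convertible with the vector built in [iint], so that the recursion of [iint] unfolds to [consrV]
    by computation. *)
Definition consrV p (z : R * 'rV[R]_p) : 'rV[R]_p.+1 :=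
  row_mx (\row_(j < 1) z.1) z.2.

Definition unconsrV p (x : 'rV[R]_p.+1) : R * 'rV[R]_p :=
  (x ord0 ord0, \row_j x ord0 (lift ord0 j)).

Lemma consrV0 p (z : R * 'rV[R]_p) : consrV z ord0 ord0 = z.1.
Proof.
rewrite /consrV (_ : ord0 = lshift p (ord0 : 'I_1)); last exact: val_inj.
by rewrite (@row_mxEl _ 1 1 p) mxE.
Qed.

Lemma consrVS p (z : R * 'rV[R]_p) j : consrV z ord0 (lift ord0 j) = z.2 ord0 j.
Proof.
rewrite /consrV (_ : lift ord0 j = rshift 1 j); last exact: val_inj.
by rewrite (@row_mxEr _ 1 1 p).
Qed.

Lemma consrVK p : cancel (@consrV p) (@unconsrV p).
Proof.
move=> z; rewrite /unconsrV consrV0 [RHS]surjective_pairing; congr pair.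
by apply/rowP => j; rewrite mxE consrVS.
Qed.

Lemma measurable_consrV p : measurable_fun setT
  (@consrV p : measurableTypeR R * rVb R p -> rVb R p.+1).
Proof.
apply: measurable_fun_rV => i; have [j ->|->] := unliftP ord0 i.
- apply: (eq_measurable_fun (fun t : measurableTypeR R * rVb R p =>
      (t.2 : 'rV[R]_p) ord0 j)) => [t _|]; first by rewrite consrVS.
  apply: (measurableT_comp (f := fun x : rVb R p => (x : 'rV[R]_p) ord0 j)) => //.
  by apply: continuous_measurable_rVR; exact: coord_continuous.
- apply: (eq_measurable_fun fst) => [t _|]; first by rewrite consrV0.
  exact: measurable_fst.
Qed.

Lemma measurable_unconsrV p : measurable_fun setT
  (@unconsrV p : rVb R p.+1 -> measurableTypeR R * rVb R p).
Proof.
apply: measurable_fun_pair.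
- by apply: continuous_measurable_rVR; exact: coord_continuous.
- apply: measurable_fun_rV => j.
  apply: (eq_measurable_fun (fun t : rVb R p.+1 =>
      (t : 'rV[R]_p.+1) ord0 (lift ord0 j))) => [t _|]; first by rewrite mxE.
  by apply: continuous_measurable_rVR; exact: coord_continuous.
Qed.

Lemma measurable_consrV_section p (x : R) : measurable_fun [set: rVb R p]
  ((fun v => consrV (x, v)) : rVb R p -> rVb R p.+1).
Proof.
apply: (measurableT_comp (@measurable_consrV p)).
exact: measurable_fun_pair.
Qed.

Section cons_measure.
Context p (mu : {sigma_finite_measure set (rVb R p) -> \bar R}).

Definition cons_measure : set (rVb R p.+1) -> \bar R :=
  pushforward (@lebesgue_measure R \x mu)%E
    (@consrV p : measurableTypeR R * rVb R p -> rVb R p.+1).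

HB.instance Definition _ := Measure.copy cons_measure
  (measure_function_pushforward__canonical__measure_function_Measure
    (@lebesgue_measure R \x mu)%E (@measurable_consrV p)).

Let cons_measure_sigma_finite : sigma_finite setT cons_measure.
Proof.
have /sigma_finiteP[F [FT ndF Foo]] := sigma_finiteT (@lebesgue_measure R).
have /sigma_finiteP[G [GT ndG Goo]] := sigma_finiteT mu.
exists (fun n => @unconsrV p @^-1` (F n `*` G n)).
  rewrite -preimage_bigcup; apply/esym; rewrite -subTset => x _ /=.
  have [k _ Fk] : (\bigcup_i F i) (unconsrV x).1 by rewrite -FT.
  have [n _ Gn] : (\bigcup_i G i) (unconsrV x).2 by rewrite -GT.
  (* Both exhausting sequences are nondecreasing, so a single index serves the two factors. *)
  exists (maxn k n) => //; split.
  - by move: Fk; exact/subsetPset/ndF/leq_maxl.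
  - by move: Gn; exact/subsetPset/ndG/leq_maxr.
move=> n; have [mF Fn] := Foo n; have [mG Gn] := Goo n; split.
  by rewrite -[X in measurable X]setTI; apply: measurable_unconsrV => //; exact: measurableX.
rewrite /cons_measure /pushforward -comp_preimage.
rewrite (_ : _ \o _ = id) ?preimage_id; last by apply/funext => z; exact: consrVK.
by rewrite product_measure1E// lte_mul_pinfty// ge0_fin_numE.
Qed.

HB.instance Definition _ := Measure_isSigmaFinite.Build _ _ _ cons_measure
  cons_measure_sigma_finite.

End cons_measure.

(** Sigma-finiteness is bundled in the recursive type because the product measure and Tonelli need
    it at each dimension. In dimension 0 the Dirac mass matches evaluation at 0 in [iint]. *)
Fixpoint lebesgue_rV p : {sigma_finite_measure set (rVb R p) -> \bar R} :=
  match p with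
  | 0 => [the {sigma_finite_measure set (rVb R 0) -> \bar R} of
          @dirac _ (rVb R 0) (0 : 'rV[R]_0) R]
  | q.+1 => [the {sigma_finite_measure set (rVb R q.+1) -> \bar R} of
             cons_measure (lebesgue_rV q)]
  end.

(** Induction on the dimension: the measure is a pushforward of a product, and Tonelli splits off
    the first coordinate. All of integration theory reaches [iint] through this identity. *)
Lemma iint_integral p (h : 'rV[R]_p -> \bar R) :
  measurable_fun [set: rVb R p] h -> (forall x, 0 <= h x)%E ->
  iint h = (\int[lebesgue_rV p]_x h x)%E.
Proof.
elim: p h => [|p ih] h mh h0.
  rewrite /= integral_dirac//= diracT mul1e //.
transitivity (\int[cons_measure (lebesgue_rV p)]_x h x)%E => //.
rewrite ge0_integral_pushforward//; last exact: measurable_consrV.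
rewrite fubini_tonelli1; last 2 first.
  by apply: measurableT_comp => //; exact: measurable_consrV.
  by move=> x /=.
rewrite /=; apply: eq_integral => x _.
rewrite ih//; exact: (measurableT_comp mh (measurable_consrV_section x)).
Qed.

Lemma integral_lebesgue_rVS p (h : 'rV[R]_p.+1 -> \bar R) :
  measurable_fun [set: rVb R p.+1] h -> (forall x, 0 <= h x)%E ->
  (\int[lebesgue_rV p.+1]_x h x =
   \int[lebesgue_measure]_x \int[lebesgue_rV p]_v h (consrV (x, v)))%E.
Proof.
move=> mh h0; rewrite -iint_integral//=; apply: eq_integral => x _.
rewrite iint_integral//; exact: (measurableT_comp mh (measurable_consrV_section x)).
Qed.

(** The pushforward of Lebesgue measure under the affine map, multiplied by [s], gives half-open
    intervals their length, hence is Lebesgue measure by uniqueness. *)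
Lemma integral_affine (f : R -> \bar R) (a s : R) : 0 < s ->
  measurable_fun [set: R] f -> (forall x, 0 <= f x)%E ->
  (s%:E * \int[lebesgue_measure]_x f (a + s * x)%R = \int[lebesgue_measure]_x f x)%E.
Proof.
move=> s0 mf f0.
pose phi := (fun x => a + s * x) : measurableTypeR R -> measurableTypeR R.
have mphi : measurable_fun [set: measurableTypeR R] phi.
  by apply: measurable_funD => //; exact: measurable_funM.
pose nu : {measure set (measurableTypeR R) -> \bar R} :=
  measure_function_pushforward__canonical__measure_function_Measure
    (@lebesgue_measure R) mphi.
have E A : measurable A -> lebesgue_measure A = (mscale (NngNum (ltW s0)) nu) A.
  apply: lebesgue_measure_unique => X /ocitvP[->|[[u v] /= uv ->]].
    by rewrite !measure0.
  rewrite /mscale /= /pushforward.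
  rewrite (_ : phi @^-1` _ = `](u - a) / s, (v - a) / s]%classic); last first.
    apply/seteqP; split => x /=; rewrite !in_itv/= /phi ltr_pdivrMr// ler_pdivlMr// [x * s]mulrC;
      by move=> /andP[? ?]; apply/andP; split; lra.
  rewrite !lebesgue_measure_itv/= !lte_fin uv ltr_pM2r ?invr_gt0// ltrD2r uv.
  by rewrite -!EFinB -EFinM; congr EFin; field; rewrite gt_eqF.
rewrite [RHS](@eq_measure_integral _ _ _ _ (mscale (NngNum (ltW s0)) nu));
  last by move=> A mA _; exact: E.
rewrite ge0_integral_mscale//; congr (_ * _)%E.
by rewrite ge0_integral_pushforward//.
Qed.

Lemma integral_lebesgue_rV_affine p (f : 'rV[R]_p -> \bar R) (a : 'rV[R]_p) (s : R) : 0 < s ->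
  measurable_fun [set: rVb R p] f -> (forall x, 0 <= f x)%E ->
  ((s ^+ p)%:E * \int[lebesgue_rV p]_x f (a + s *: x)%R = \int[lebesgue_rV p]_x f x)%E.
Proof.
move=> s0; elim: p f a => [|p ih] f a mf f0.
  rewrite expr0 mul1e; apply: eq_integral => x _; congr f.
  by apply/rowP => -[].
have maff := @measurable_affine_rV R p.+1 a s.
rewrite (integral_lebesgue_rVS mf f0).
rewrite (integral_lebesgue_rVS (measurableT_comp mf maff))//.
pose F (y : R) := (\int[lebesgue_rV p]_v f (consrV (y, v)))%E.
have mF : measurable_fun [set: R] F.
  apply: (@measurable_fun_fubini_tonelli_F _ _ (measurableTypeR R) (rVb R p) R
    (lebesgue_rV p) (fun z => f (consrV z))) => //.
  exact: (measurableT_comp mf (@measurable_consrV p)).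
have F0 y : (0 <= F y)%E by apply: integral_ge0.
rewrite -(@integral_affine F (a ord0 ord0) s)// exprS EFinM -muleA; congr (_ * _)%E.
have mG : measurable_fun [set: R] (fun x => F (a ord0 ord0 + s * x)).
  apply: (measurableT_comp mF); apply: measurable_funD => //; exact: measurable_funM.
pose G (x : R) := (\int[lebesgue_rV p]_v f (a + s *: consrV (x, v))%R)%E.
(* The induction hypothesis, applied with the tail of [a] as translation, handles the remaining
   coordinates and contributes [s ^+ p]; the last factor [s] comes from the first coordinate. *)
have GF x : ((s ^+ p)%:E * G x = F (a ord0 ord0 + s * x)%R)%E.
  rewrite /F -(ih _ (unconsrV a).2)//; last first.
    exact: (measurableT_comp mf (measurable_consrV_section _)).
  congr (_ * _)%E; apply: eq_integral => v _; congr f.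
  have e n (b w : 'rV[R]_n) i : (b + s *: w) ord0 i = b ord0 i + s * w ord0 i by rewrite !mxE.
  apply/rowP => j; have [k ->|->] := unliftP ord0 j.
  - by rewrite e !consrVS e mxE.
  - by rewrite e !consrV0.
rewrite -ge0_integralZl//.
- by apply: eq_integral => x _; rewrite -GF.
- apply: (@measurable_fun_fubini_tonelli_F _ _ (measurableTypeR R) (rVb R p) R
    (lebesgue_rV p) (fun z => f (a + s *: consrV z))) => //.
  exact: (measurableT_comp (measurableT_comp mf maff) (@measurable_consrV p)).
- by move=> x _; apply: integral_ge0 => v _; exact: f0.
- by rewrite lee_fin exprn_ge0// ltW.
by move=> x /=; exact: f0.
Qed.

End lebesgue_rV.

(** * The Gaussian integral *)

Section schur.
Context {R : realType} (p : nat) (H : 'M[R]_(1 + p)).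
Context (Hsym : symmetric_mx H).
Let b : 'M[R]_(1, p) := ursubmx H.
Let D : 'M[R]_p := drsubmx H.
Context (Dunit : D \in unitmx).

(** The shift that completes the square in the trailing coordinates; see [qform_schur]. *)
Definition schur_row : 'rV[R]_p := ursubmx H *m invmx (drsubmx H).
Definition schur_compl : R := H ord0 ord0 - (schur_row *m (ursubmx H)^T) ord0 ord0.

Let w := schur_row.
Let s := schur_compl.

Lemma drsubmx_symmetric : symmetric_mx D.
Proof. by rewrite /symmetric_mx /D trmx_drsub Hsym. Qed.

Let Hblock : H = block_mx (H ord0 ord0)%:M b b^T D.
Proof.
rewrite -[LHS]submxK; congr block_mx.
- by rewrite [LHS]mx11_scalar !mxE; congr (H _ _)%:M; exact: val_inj.
- by rewrite /b trmx_ursub Hsym.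
Qed.

Let wD : w *m D = b.
Proof. by rewrite /w /schur_row mulmxKV. Qed.

Let Dw : D *m w^T = b^T.
Proof. by rewrite -{1}drsubmx_symmetric -trmx_mul wD. Qed.

(** Expanding the right side, [w *m D = b] and the symmetry of [D] reproduce the cross terms; the
    surplus in t^2 is what the Schur complement subtracts. *)
Lemma qform_schur (t : R) (v : 'rV[R]_p) :
  qform H (consrV (t, v)) = s * t ^+ 2 + qform D (v + t *: w).
Proof.
have -> : consrV (t, v) = row_mx t%:M v.
  by apply: (congr1 (fun z : 'rV_1 => row_mx z v)); apply/rowP => j; rewrite !ord1 !mxE eqxx.
rewrite /qform {1}Hblock mul_row_block tr_row_mx mul_row_col.
rewrite tr_scalar_mx -scalar_mxM !mul_scalar_mx mul_mx_scalar.
have -> : (v + t *: w)^T = v^T + t *: w^T by apply/matrixP => i j; rewrite !mxE.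
rewrite !mulmxDl !mulmxDr -!scalemxAl -!scalemxAr.
rewrite wD -(mulmxA v D w^T) Dw.
have bw : b *m w^T = w *m b^T by rewrite -Dw -{1}wD !mulmxA.
(* The two cross terms are 1 by 1 matrices and transposes of each other. *)
have bv : (b *m v^T) ord0 ord0 = (v *m b^T) ord0 ord0.
  by rewrite -[RHS](mxE trmx_key (fun i j => (v *m b^T) j i)) -/(trmx _) trmx_mul trmxK.
rewrite bw /s /schur_compl -/w -/b.
clear bw; move: bv.
(* Abstracting the products keeps [mxE] from expanding them into sums, which leaves a ring identity
   in their entries. *)
move: (b *m v^T) (v *m b^T) (w *m b^T) (v *m D *m v^T) => B C W V BC.
by rewrite !mxE eqxx mulr1n BC; ring.
Qed.

(** [H] factors as a unit upper block triangular matrix times a lower block triangular one with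
    diagonal blocks [s] and [D]. *)
Lemma det_schur : \det H = s * \det D.
Proof.
rewrite Hblock.
have -> : block_mx (H ord0 ord0)%:M b b^T D =
    block_mx 1%:M w 0 1%:M *m block_mx s%:M 0 b^T D.
  rewrite mulmx_block !mul1mx !mul0mx !add0r wD; congr block_mx.
  rewrite [w *m _]mx11_scalar -raddfD /= /s /schur_compl -/w; congr (_%:M).
  by rewrite subrK.
by rewrite det_mulmx det_ublock det_lblock !det1 mul1r mul1r det_scalar1.
Qed.
End schur.

Section gauss_rV.
Context {R : realType}.

Lemma cvg_sum_ord (T : Type) (F : set_system T) {FF : Filter F} n
    (g : 'I_n -> T -> R) (l : 'I_n -> R) :
  (forall i, g i @ F --> l i) -> \sum_(i < n) g i x @[x --> F] --> \sum_(i < n) l i.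
Proof. by move=> h; apply: cvg_big => // z; exact: add_continuous. Qed.

Lemma qform_sum p (H : 'M[R]_p) x :
  qform H x = \sum_(i < p) \sum_(j < p) x ord0 i * H i j * x ord0 j.
Proof.
rewrite /qform mxE exchange_big /=; apply: eq_bigr => j _.
by rewrite mxE big_distrl; apply: eq_bigr => i _; rewrite !mxE.
Qed.

Lemma qform_continuous p (H : 'M[R]_p) : continuous (qform H).
Proof.
move=> x; rewrite (_ : qform H =
    fun x => \sum_(i < p) \sum_(j < p) x ord0 i * H i j * x ord0 j); last first.
  by apply/funext => y; exact: qform_sum.
apply: (@cvg_sum_ord _ (nbhs x)) => i; apply: (@cvg_sum_ord _ (nbhs x)) => j.
apply: cvgM; last exact: coord_continuous.
by apply: cvgMr_tmp; exact: coord_continuous.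
Qed.

Lemma enorm_continuous p : continuous (@enorm R p).
Proof.
move=> x; rewrite /enorm.
apply: (@continuous_comp _ _ _ (fun y : 'rV[R]_p => \sum_(i < p) y ord0 i ^+ 2) Num.sqrt).
  apply: (@cvg_sum_ord _ (nbhs x)) => i.
  by apply: (@continuous_comp _ _ _ (fun y : 'rV[R]_p => y ord0 i) (fun r => r ^+ 2));
    [exact: coord_continuous|exact: exprn_continuous].
exact: sqrt_continuous.
Qed.

(** The substitution with s = sqrt (a / 2) reduces this to the integral of exp (- x^2). *)
Lemma integral_gauss1 (a : R) : 0 < a ->
  (\int[lebesgue_measure]_x (expR (- (a * x ^+ 2) / 2))%:E =
   (Num.sqrt (2 * pi) / Num.sqrt a)%:E)%E.
Proof.
move=> a0; pose s := Num.sqrt (a / 2).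
have s0 : 0 < s by rewrite sqrtr_gt0 divr_gt0.
have := @integral_affine R (fun x => (gauss_fun x)%:E) 0 s s0.
rewrite integralT_gauss => h.
have s2 : s ^+ 2 = a / 2 by rewrite sqr_sqrtr// divr_ge0// ltW.
transitivity (s^-1%:E * (s%:E * \int[lebesgue_measure]_x (gauss_fun (0 + s * x))%:E))%E.
  rewrite muleA -EFinM mulVf ?gt_eqF// mul1e; apply: eq_integral => x _.
  by rewrite /gauss_fun add0r exprMn s2; congr (expR _)%:E; field.
rewrite h; last 2 first.
- by apply/measurable_EFinP; exact: measurable_gauss_fun.
- by move=> x; rewrite lee_fin; exact: gauss_fun_ge0.
rewrite -EFinM; congr EFin.
rewrite /s [Num.sqrt (a / 2)]sqrtrM ?ltW// sqrtrM// sqrtrV//.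
by field; rewrite !gt_eqF// sqrtr_gt0.
Qed.

Lemma qform0 p (H : 'M[R]_p) : qform H 0 = 0.
Proof. by rewrite /qform !mul0mx mxE. Qed.

(** The form of the trailing block is that of [H] on vectors whose first coordinate vanishes. *)
Lemma posdef_drsubmx p (H : 'M[R]_(1 + p)) : posdef_mx H -> posdef_mx (drsubmx H : 'M[R]_p).
Proof.
move=> [Hs Hp]; split; first exact: drsubmx_symmetric.
move=> v v0.
have -> : qform (drsubmx H) v = qform H (row_mx 0 v : 'rV[R]_(1 + p)).
  rewrite /qform -{2}(submxK H) mul_row_block tr_row_mx mul_row_col !mul0mx trmx0.
  by rewrite !mulmx0 !add0r.
by apply: Hp; apply: contra v0 => /eqP e; rewrite -(@row_mxKr _ 1 1 p 0 v) e linear0.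
Qed.

Lemma measurable_gauss_rV p (H : 'M[R]_p) :
  measurable_fun [set: rVb R p] (fun x => (expR (- (qform H x) / 2))%:E).
Proof.
apply/measurable_EFinP; apply: (measurableT_comp (f := fun r : R => expR (- r / 2))).
  by apply: measurableT_comp => //; apply: measurable_funM.
by apply: continuous_measurable_rVR; exact: qform_continuous.
Qed.

(** Positivity of the determinant goes through the same induction: it makes the trailing block
    invertible, as the Schur complement requires. *)
Lemma integral_gauss_rV p (H : 'M[R]_p) : posdef_mx H -> 0 < \det H /\
  (\int[lebesgue_rV p]_x (expR (- (qform H x) / 2))%:E =
   (Num.sqrt (2 * pi) ^+ p / Num.sqrt (\det H))%:E)%E.
Proof.
elim: p H => [|p ih] H Hp.
  split; first by rewrite det_mx00.
  rewrite /= integral_dirac//=; last exact: measurable_gauss_rV.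
  rewrite {1}/dirac indicT mul1e expr0 det_mx00 sqrtr1 divr1.
  by rewrite qform0 oppr0 mul0r expR0.
have [d0 ihD] := ih _ (@posdef_drsubmx p H Hp).
have Du : (drsubmx (H : 'M[R]_(1 + p)) : 'M[R]_p) \in unitmx by rewrite unitmxE unitfE gt_eqF.
pose s := schur_compl (H : 'M[R]_(1 + p)).
pose w := schur_row (H : 'M[R]_(1 + p)).
have qE := @qform_schur R p H Hp.1 Du; have dE := @det_schur R p H Hp.1 Du.
rewrite -/s -/w in qE dE.
have s0 : 0 < s.
  (* The Schur complement is the value of the form at the nonzero vector (1, - w). *)
  have := qE 1 (- w); rewrite scale1r addNr qform0 addr0 expr1n mulr1 => <-.
  apply: Hp.2; apply/eqP => /(congr1 (fun z : 'rV_p.+1 => z ord0 ord0)).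
  by rewrite consrV0 mxE /= => /eqP; rewrite oner_eq0.
split; first by rewrite dE mulr_gt0.
rewrite integral_lebesgue_rVS; [|exact: measurable_gauss_rV|by move=> x; rewrite lee_fin expR_ge0].
(* [K] hides the value given by the induction hypothesis until the final computation. *)
have [K KE] : exists K, K =
    Num.sqrt (2 * pi) ^+ p / Num.sqrt (\det (drsubmx (H : 'M[R]_(1 + p)) : 'M[R]_p)).
  by eexists.
have K0 : 0 <= K by rewrite KE divr_ge0// ?exprn_ge0// sqrtr_ge0.
rewrite -KE in ihD.
(* For fixed [t], completing the square makes the integrand a translate by [t *: w] of the
   lower-dimensional Gaussian; translation invariance is the affine change of variables with scale
   1. *)
have inner t : (\int[lebesgue_rV p]_v (expR (- qform H (consrV (t, v)) / 2))%:E =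
     (expR (- (s * t ^+ 2) / 2))%:E * K%:E)%E.
  pose gD (v : 'rV[R]_p) := (expR (- qform (drsubmx (H : 'M[R]_(1 + p)) : 'M[R]_p) v / 2))%:E.
  have gD0 v : (0 <= gD v)%E by rewrite lee_fin expR_ge0.
  have aff := @integral_lebesgue_rV_affine _ p gD (t *: w) 1 ltr01 (measurable_gauss_rV _) gD0.
  rewrite expr1n mul1e in aff.
  transitivity ((expR (- (s * t ^+ 2) / 2))%:E *
    \int[lebesgue_rV p]_v gD (t *: w + 1 *: v)%R)%E; last first.
    by congr (_ * _)%E; rewrite aff; exact: ihD.
  rewrite -ge0_integralZl.
  - apply: eq_integral => v _; rewrite /gD -EFinM -expRD qE scale1r [t *: w + v]addrC.
    by congr (expR _)%:E; field.
  - exact: measurableT.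
  - exact: (measurableT_comp (measurable_gauss_rV _) (measurable_affine_rV _ _)).
  - by move=> v _; exact: gD0.
  - by rewrite lee_fin expR_ge0.
under eq_integral => t _ do rewrite inner.
rewrite ge0_integralZr; last 4 first.
- exact: measurableT.
- apply/measurable_EFinP; apply: measurableT_comp => //; apply: measurable_funM => //.
  by apply: measurableT_comp => //; apply: measurable_funM => //; exact: measurable_funX.
- by move=> t _; rewrite lee_fin expR_ge0.
- by rewrite lee_fin.
rewrite integral_gauss1// -EFinM; congr EFin.
rewrite KE dE (sqrtrM _ (ltW s0)) exprS; field.
by rewrite !gt_eqF// sqrtr_gt0.
Qed.
End gauss_rV.

(** * Norms, quadratic forms and limits *)

Section norms_and_forms.
Context {R : realType}.
Implicit Type p : nat.

Lemma enorm_ge0 p (x : 'rV[R]_p) : 0 <= enorm x.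
Proof. exact: sqrtr_ge0. Qed.

Lemma sqr_enorm p (x : 'rV[R]_p) : enorm x ^+ 2 = \sum_(i < p) x ord0 i ^+ 2.
Proof. by rewrite sqr_sqrtr// sumr_ge0// => i _; exact: sqr_ge0. Qed.

Lemma enormZ p (a : R) (x : 'rV[R]_p) : enorm (a *: x) = `|a| * enorm x.
Proof.
rewrite /enorm -sqrtr_sqr -sqrtrM ?sqr_ge0// mulr_sumr.
by congr Num.sqrt; apply: eq_bigr => i _; rewrite mxE exprMn.
Qed.

Lemma le_coord_enorm p (x : 'rV[R]_p) i : `|x ord0 i| <= enorm x.
Proof.
rewrite -sqrtr_sqr ler_wsqrtr// (bigD1 i)//= lerDl sumr_ge0// => j _.
exact: sqr_ge0.
Qed.

Lemma enorm_eq0 p (x : 'rV[R]_p) : enorm x = 0 -> x = 0.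
Proof.
move=> x0; apply/rowP => i; rewrite mxE; apply/eqP; rewrite -normr_le0 -x0.
exact: le_coord_enorm.
Qed.

Lemma norm_rV_le p (x : 'rV[R]_p) (e : R) :
  0 <= e -> (forall i, `|x ord0 i| <= e) -> `|x| <= e.
Proof.
move=> e0 xe; rewrite /Num.norm/= mx_normrE; apply/bigmax_leP; split=> // -[i j] _.
by rewrite ord1.
Qed.

Lemma qformZ p (H : 'M[R]_p) a x : qform H (a *: x) = a ^+ 2 * qform H x.
Proof.
rewrite !qform_sum mulr_sumr; apply: eq_bigr => i _.
by rewrite mulr_sumr; apply: eq_bigr => j _; rewrite !mxE; ring.
Qed.

(** The form attains a positive minimum on the compact unit sphere, and homogeneity extends the
    bound to all vectors. *)
Lemma posdef_ge_enorm p (H : 'M[R]_p) : posdef_mx H ->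
  exists2 lam : R, 0 < lam & forall x, lam * enorm x ^+ 2 <= qform H x.
Proof.
move=> [_ Hp]; have [[x0 x01]|none] := pselect (exists x : 'rV[R]_p, enorm x = 1).
  have [||c cS cmin] := @EVT_min_rV R p (qform H) [set x | enorm x = 1] (ex_intro _ x0 x01).
  - apply: bounded_closed_compact.
      exists 1; split => // M M1 x /= ex1.
      apply: norm_rV_le => [|i]; first by rewrite ltW// (lt_trans _ M1).
      by rewrite (le_trans (le_coord_enorm _ _))// ex1 ltW.
    rewrite (_ : [set _ | _] = (@enorm R p) @^-1` [set 1])//.
    by apply: preimage_closed; [move=> x _; exact: enorm_continuous|exact: closed_eq].
  - exact/continuous_subspaceT/qform_continuous.
  move: cS; rewrite inE/= => c1; exists (qform H c).
    apply: Hp; apply/eqP => c0; move: c1; rewrite c0 /enorm big1 ?sqrtr0.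
      by move/eqP; rewrite eq_sym oner_eq0.
    by move=> i _; rewrite mxE expr0n.
  move=> x; have [x0'|x0'] := eqVneq (enorm x) 0.
    by rewrite x0' (enorm_eq0 x0') qform0 expr0n mulr0.
  have ex : enorm ((enorm x)^-1 *: x) = 1.
    by rewrite enormZ ger0_norm ?invr_ge0 ?enorm_ge0// mulVf.
  have : qform H c <= qform H ((enorm x)^-1 *: x) by apply: cmin; rewrite inE.
  by rewrite qformZ exprVn mulrC ler_pdivlMr// exprn_gt0// lt_neqAle eq_sym x0' enorm_ge0.
(* Without unit vectors (dimension 0) every norm is 0, since a nonzero one could be normalized; any
   constant then works. *)
exists 1 => // x; suff -> : enorm x = 0.
  rewrite expr0n mulr0; have [->|/Hp/ltW//] := eqVneq x 0; by rewrite qform0.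
apply/eqP; apply: contrapT => /negP x0; apply: none; exists ((enorm x)^-1 *: x).
by rewrite enormZ ger0_norm ?invr_ge0 ?enorm_ge0// mulVf.
Qed.

(** A crude bound by the sum of the entries, enough to turn entrywise convergence of matrices into
    control of forms uniform in the direction. *)
Lemma qform_le_enorm p (K : 'M[R]_p) x :
  `|qform K x| <= (\sum_(i < p) \sum_(j < p) `|K i j|) * enorm x ^+ 2.
Proof.
rewrite qform_sum mulr_suml (le_trans (ler_norm_sum _ _ _))// ler_sum// => i _.
rewrite mulr_suml (le_trans (ler_norm_sum _ _ _))// ler_sum// => j _.
rewrite !normrM mulrAC expr2 [leRHS]mulrC ler_wpM2r//.
by rewrite ler_pM// le_coord_enorm.
Qed.

Lemma dotv_le_enorm p (x c : 'rV[R]_p) :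
  dotv x c <= (\sum_(i < p) `|c ord0 i|) * enorm x.
Proof.
rewrite /dotv mxE mulr_suml ler_sum// => i _; rewrite mxE.
rewrite (le_trans (ler_norm _))// normrM mulrC ler_wpM2l//.
exact: le_coord_enorm.
Qed.

Lemma qformB p (K L : 'M[R]_p) x : qform (K - L) x = qform K x - qform L x.
Proof. by rewrite /qform mulmxBr mulmxBl !mxE. Qed.

Lemma cvg_sum_norm_mx m n (K : nat -> 'M[R]_(m, n)) (L : 'M[R]_(m, n)) :
  K @ \oo --> L -> (fun k => \sum_(i < m) \sum_(j < n) `|(K k - L) i j|) @ \oo --> 0.
Proof.
move=> KL; rewrite [X in _ --> X](_ : 0 = \sum_(i < m) \sum_(j < n) (0 : R)); last first.
  by rewrite big1// => i _; rewrite big1.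
apply: (@cvg_sum_ord _ _ (\oo)) => i; apply: (@cvg_sum_ord _ _ (\oo)) => j.
apply/norm_cvg0P; rewrite (_ : (fun k => _) = (fun k => K k i j - L i j)); last first.
  by apply/funext => k; rewrite !mxE.
apply/subr_cvg0.
exact: (continuous_cvg _ (@coord_continuous R m n i j L)).
Qed.

End norms_and_forms.

Section limits.
Context {R : realType}.

(** The limit superior is the infimum of the tail suprema, so some tail supremum is below +oo; it is
    not -oo because it dominates a real number. *)
Lemma limn_esup_near_le (d : nat -> R) : (limn_esup (fun n => (d n)%:E) < +oo)%E ->
  exists D : R, \forall n \near \oo, d n <= D.
Proof.
rewrite limn_esup_lim (cvg_lim _ (@cvg_esups_inf _ _))// => /ereal_inf_lt[_ [N _ <-]] h.
have dn n : (N <= n)%N -> ((d n)%:E <= esups (fun n => (d n)%:E) N)%E.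
  by move=> Nn; apply: ereal_sup_ubound; exists n.
case: (esups _ N) h dn => [r _ dn|//|_ dn].
- by exists r; exists N => // n /= /dn; rewrite lee_fin.
- by have := dn N (leqnn _).
Qed.

Lemma limn_einf_near_ge (u : nat -> \bar R) : (0 < limn_einf u)%E ->
  exists2 eta : R, 0 < eta & \forall n \near \oo, (eta%:E <= u n)%E.
Proof.
rewrite limn_einf_lim (cvg_lim _ (@cvg_einfs_sup _ _))// => /ereal_sup_gt[_ [N _ <-]] h.
have un n : (N <= n)%N -> (einfs u N <= u n)%E.
  by move=> Nn; apply: ereal_inf_lbound; exists n.
case: (einfs u N) h un => [r r0 un|_ un|//].
- by exists r; [|exists N].
(* An infinite tail infimum does occur, for instance when an infimum in (C2) runs over an empty set;
   the choice of 1 is arbitrary. *)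
- by exists 1 => //; exists N => // n /= /un; apply: le_trans; rewrite leey.
Qed.

(** Since sqrt n ^ p <= n ^ p for n >= 1, and the exponential exceeds the term of degree p + 1 of
    its series, the product is at most C / n. *)
Lemma cvg_sqrtn_expR0 (p : nat) (eta : R) : 0 < eta ->
  (fun n : nat => Num.sqrt n%:R ^+ p * expR (- (eta * n%:R))) @ \oo --> 0.
Proof.
move=> eta0; pose C : R := (p.+1)`!%:R / eta ^+ p.+1.
apply: (@squeeze_cvgr _ _ _ _ (fun=> 0) (fun n : nat => C * n%:R^-1)).
- near=> n.
  have n0 : 0 < n%:R :> R by rewrite ltr0n; near: n; exact: nbhs_infty_gt.
  have n1 : 1 <= n%:R :> R by rewrite ler1n -(ltr0n R).
  rewrite mulr_ge0 ?exprn_ge0 ?sqrtr_ge0 ?expR_ge0//= expRN.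
  rewrite ler_pdivrMr ?expR_gt0//.
  have : 1 + (eta * n%:R) ^+ p.+1 / (p.+1)`!%:R <= expR (eta * n%:R).
    by apply: expR_ge1Dxn; rewrite mulr_ge0// ltW.
  have C0 : 0 < C by rewrite divr_gt0 ?exprn_gt0// ltr0n fact_gt0.
  have -> : (eta * n%:R) ^+ p.+1 / (p.+1)`!%:R = C^-1 * n%:R ^+ p.+1.
    by rewrite /C exprMn invf_div mulrAC.
  move=> le1; have {}le1 : C^-1 * n%:R ^+ p.+1 <= expR (eta * n%:R) by lra.
  apply: (@le_trans _ _ (C / n%:R * (C^-1 * n%:R ^+ p.+1))); last first.
    by rewrite ler_wpM2l// divr_ge0// ltW.
  rewrite exprS (_ : _ * _ = n%:R ^+ p); last by field; rewrite !gt_eqF.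
  have sqn : Num.sqrt n%:R <= n%:R :> R.
    have h : n%:R = Num.sqrt (n%:R ^+ 2) :> R by rewrite sqrtr_sqr ger0_norm// ltW.
    by rewrite [leRHS]h ler_wsqrtr// expr2 ler_peMl// ltW.
  by apply: lerXn2r => //; rewrite nnegrE ?sqrtr_ge0 ?ltW.
- exact: cvg_cst.
- rewrite -[X in _ --> X](mulr0 C); apply: cvgM; first exact: cvg_cst.
  apply/gtr0_cvgV0; last exact: cvgr_idn.
  by near=> n; rewrite ltr0n; near: n; exact: nbhs_infty_gt.
Unshelve. all: by end_near. Qed.

End limits.

(** * Convergence of the rescaled posterior *)

(* Scheffe-type estimate; it also holds when [Y = 0], where [h x / Y] is [0]. *)
Lemma integral_normalized_dist d (T : measurableType d) (R : realType)
    (mu : {measure set T -> \bar R}) (h g : T -> R) (Y Z : R) :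
  measurable_fun setT h -> measurable_fun setT g ->
  (forall x, 0 <= h x) -> (forall x, 0 <= g x) ->
  (\int[mu]_x (h x)%:E = Y%:E)%E -> (\int[mu]_x (g x)%:E = Z%:E)%E -> 0 < Z ->
  (\int[mu]_x (`| h x / Y - g x / Z |)%:E <=
   (2 / Z)%:E * \int[mu]_x (`| h x - g x |)%:E)%E.
Proof.
move=> mh mg h0 g0 hY gZ Z0.
have mhE : measurable_fun setT (fun x => (h x)%:E) by exact/measurable_EFinP.
have mgE : measurable_fun setT (fun x => (g x)%:E) by exact/measurable_EFinP.
have mhg : measurable_fun setT (fun x => (`|h x - g x|)%:E).
  by apply/measurable_EFinP; apply: measurableT_comp => //; exact: measurable_funB.
have Y0 : 0 <= Y by rewrite -lee_fin -hY integral_ge0// => x _; rewrite lee_fin.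
pose I := (\int[mu]_x (`| h x - g x |)%:E)%E.
have I0 : (0 <= I)%E by apply: integral_ge0 => x _; rewrite lee_fin.
have YZI : (Y%:E <= Z%:E + I)%E.
  rewrite -hY -gZ -ge0_integralD//; last by move=> x _; rewrite lee_fin.
  - apply: ge0_le_integral => //.
    + by move=> x _; rewrite lee_fin.
    + exact: emeasurable_funD.
    + by move=> x _; rewrite -EFinD lee_fin -lerBlDl ler_norm.
have ZYI : (Z%:E <= Y%:E + I)%E.
  rewrite -hY -gZ -ge0_integralD//; last by move=> x _; rewrite lee_fin.
  - apply: ge0_le_integral => //.
    + by move=> x _; rewrite lee_fin.
    + exact: emeasurable_funD.
    + by move=> x _; rewrite -EFinD lee_fin -lerBlDl distrC ler_norm.
apply: (@le_trans _ _ ((`|Y^-1 - Z^-1|)%:E * Y%:E + (Z^-1)%:E * I)%E).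
  have Zi0 : 0 <= Z^-1 by rewrite invr_ge0 ltW.
  have hE0 x : [set: T] x -> (0 <= (h x)%:E)%E by rewrite lee_fin.
  have hgE0 x : [set: T] x -> (0 <= (`|h x - g x|)%:E)%E by rewrite lee_fin.
  rewrite -hY -(ge0_integralZl mu measurableT mhE hE0) ?lee_fin//.
  rewrite -(ge0_integralZl mu measurableT mhg hgE0) ?lee_fin//.
  rewrite -(ge0_integralD mu measurableT); first last.
  - exact: emeasurable_funM.
  - by move=> x _; rewrite -EFinM lee_fin mulr_ge0.
  - exact: emeasurable_funM.
  - by move=> x _; rewrite -EFinM lee_fin mulr_ge0.
  apply: ge0_le_integral => //.
  - apply/measurable_EFinP; apply: measurableT_comp => //.
    by apply: measurable_funB; apply: measurable_funM.
  - by apply: emeasurable_funD; apply: emeasurable_funM.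
  - move=> x _; rewrite -!EFinM -EFinD lee_fin.
    (* The first term integrates to at most |1/Y - 1/Z| Y = |Z - Y| / Z when Y is nonzero, which is
       again bounded by the L^1 distance over Z; this explains the factor 2. *)
    have -> : h x / Y - g x / Z = (Y^-1 - Z^-1) * h x + Z^-1 * (h x - g x) by ring.
    rewrite (le_trans (ler_normD _ _))// !normrM (ger0_norm (h0 x)).
    by rewrite (@ger0_norm _ Z^-1)// invr_ge0 ltW.
rewrite -/I; case: I I0 YZI ZYI => [i|_ _ _|//]; last first.
  by rewrite [X in (_ <= X)%E]gt0_muley ?lte_fin ?divr_gt0// leey.
rewrite -!EFinM -!EFinD !lee_fin => i0 YZ ZY.
have -> : 2 / Z * i = Z^-1 * i + Z^-1 * i by ring.
rewrite lerD2r; have [->|Yn0] := eqVneq Y 0.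
  by rewrite mulr0 mulr_ge0// invr_ge0 ltW.
rewrite -{2}(ger0_norm Y0) -normrM mulrBl mulVf//.
have -> : 1 - Z^-1 * Y = Z^-1 * (Z - Y) by field; rewrite gt_eqF.
have Zi0 : 0 <= Z^-1 by rewrite invr_ge0 ltW.
rewrite normrM (ger0_norm Zi0) ler_wpM2l//.
by rewrite ler_norml; lra.
Qed.

Lemma qform_scalar (R : realType) p (a : R) (x : 'rV[R]_p) :
  qform a%:M x = a * enorm x ^+ 2.
Proof.
rewrite /qform mul_mx_scalar -scalemxAl mxE sqr_enorm; congr (_ * _).
by rewrite mxE; apply: eq_bigr => i _; rewrite mxE expr2.
Qed.

Lemma posdef_scalar (R : realType) p (a : R) : 0 < a -> posdef_mx (a%:M : 'M[R]_p).
Proof.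
move=> a0; split; first exact: tr_scalar_mx.
move=> x x0; rewrite qform_scalar mulr_gt0// exprn_gt0// lt_neqAle enorm_ge0 andbT.
by apply: contra x0 => /eqP /esym /enorm_eq0 ->.
Qed.

Section rescaled_posterior.
Context {R : realType} (p : nat).
Context (pi0 : 'rV[R]_p -> R) (theta0 : 'rV[R]_p).
Context (f : nat -> 'rV[R]_p -> R) (theta : nat -> 'rV[R]_p).
Context (H : nat -> 'M[R]_p) (H0 : 'M[R]_p) (r : nat -> 'rV[R]_p -> R).
Context (eps0 c0 : R) (c : nat -> 'rV[R]_p) (d : nat -> R).

Local Notation u n := (Num.sqrt (n%:R : R)).

Definition rescale n (x : 'rV[R]_p) : 'rV[R]_p := theta n + (u n)^-1 *: x.

(** The [g_n] of the overview. Dividing by exp (f_n theta_n) changes nothing after normalization,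
    and is what gives a pointwise limit. *)
Definition tilted n (x : 'rV[R]_p) : R :=
  expR (f n (rescale n x) - f n (theta n)) * pi0 (rescale n x).

Context (pi0_ge0 : forall t, 0 <= pi0 t).
Context (pi0_cont : {for theta0, continuous pi0}).
Context (thetaP : theta @ \oo --> theta0).
Context (HP : H @ \oo --> H0) (H0pos : posdef_mx H0).
Context (fE : forall n t, f n t = f n (theta n) - n%:R / 2 * qform (H n) (t - theta n)
                               + r n t).
Context (r0 : forall x : 'rV[R]_p,
   (fun n => r n (theta n + (u n)^-1 *: x) - r n (theta n)) @ \oo --> 0).
Context (eps0_gt0 : 0 < eps0) (c0_ge0 : 0 <= c0).
Context (cP : c @ \oo --> (0 : 'rV[R]_p)).
Context (dP : (limn_esup (fun n => (d n)%:E) < +oo)%E).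
Context (rle : forall n (x : 'rV[R]_p), enorm x < eps0 * u n ->
   r n (theta n + (u n)^-1 *: x) - r n (theta n)
                <= c0 * enorm x ^+ 3 / u n + dotv x (c n) + d n).
Context (C2 : forall eps : R, 0 < eps < eps0 ->
   (0 < limn_einf (fun n =>
      ereal_inf [set ((f n (theta n) - f n t) / n%:R)%:E
          | t in [set t : 'rV[R]_p | (eps <= enorm (t - theta n))%R]]))%E).

Lemma tilted_ge0 n x : 0 <= tilted n x.
Proof. by rewrite mulr_ge0// expR_ge0. Qed.

Lemma u_gt0 n : (0 < n)%N -> 0 < u n.
Proof. by move=> n0; rewrite sqrtr_gt0 ltr0n. Qed.

Lemma log_ratio n x : (0 < n)%N ->
  f n (rescale n x) - f n (theta n) =
  - qform (H n) x / 2 + (r n (rescale n x) - r n (theta n)).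
Proof.
(* The expansion in (C1) taken at [theta n] itself forces the remainder to vanish there. *)
move=> n0; have rn0 : r n (theta n) = 0.
  by have := fE n (theta n); rewrite subrr qform0 mulr0 subr0 => h; lra.
have un := u_gt0 n0.
rewrite (fE n (rescale n x)) rn0.
have -> : rescale n x - theta n = (u n)^-1 *: x by rewrite /rescale addrAC subrr add0r.
rewrite qformZ exprVn sqr_sqrtr ?ler0n//.
have n0' : n%:R != 0 :> R by rewrite pnatr_eq0 -lt0n.
by field.
Qed.

(** Bookkeeping of the exponent: [Q] is the quadratic form, [T] the cubic term, [V] the linear one,
    [E] and [E2] the norm and its square, [li] stands for 2 / l. Of the 3l/8 from the form, the
    cubic and linear terms take l/8 each, leaving l/8. *)
Let exponent_bound (l li Q S T V E E2 dn D : R) :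
  3 / 4 * l * E2 <= Q -> S <= T + V + dn -> T <= l / 8 * E2 -> V <= E ->
  E <= l / 8 * E2 + li -> dn <= D -> - Q / 2 + S <= li + D + - (l / 4 * E2) / 2.
Proof. by lra. Qed.

Let form_bound (l Q B E2 : R) :
  l * E2 <= B -> - (l / 4 * E2) <= Q - B -> 3 / 4 * l * E2 <= Q.
Proof. by lra. Qed.

Lemma tilted_inner_bound : exists delta lam K : R,
  [/\ 0 < delta < eps0, 0 < lam, 0 < K &
   \forall n \near \oo, forall x, enorm x < delta * u n ->
     tilted n x <= K * expR (- (qform lam%:M x) / 2)].
Proof.
have [l l0 lE] := posdef_ge_enorm H0pos.
have [D dD] := limn_esup_near_le dP.
have /cvgrPdist_lt/(_ 1 ltr01)/nbhs_ballP[rho /= rho0 rhoP] := pi0_cont.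
(* The three bounds serve, in order, the range of (C1), the stay of t within [rho] of [theta0], and
   the bound of the cubic term by l/8 times the squared norm. The 1 added to [c0] avoids a zero
   denominator. *)
pose delta := Num.min (eps0 / 2) (Num.min (rho / 2) (l / (8 * (c0 + 1)))).
have c1 : 0 < c0 + 1 by move: c0_ge0; lra.
have d0 : 0 < delta by rewrite !lt_min !divr_gt0// mulr_gt0.
have d1 : delta <= eps0 / 2 by rewrite ge_min lexx.
have d2 : delta <= rho / 2 by rewrite !ge_min lexx orbT.
have d3 : c0 * delta <= l / 8.
  have : delta <= l / (8 * (c0 + 1)) by rewrite !ge_min lexx !orbT.
  rewrite invfM mulrA ler_pdivlMr// => h; apply: le_trans h.
  by rewrite mulrC ler_wpM2l ?ltW//; lra.
(* The factors of [K] bound the density near [theta0], and the exponential of the constants left by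
   AM-GM (2 / l) and by [d n] ([D]). *)
exists delta, (l / 4), ((pi0 theta0 + 1) * expR (2 / l + D)); split.
- by rewrite d0/=; move: eps0_gt0; lra.
- by rewrite divr_gt0.
- by rewrite mulr_gt0 ?expR_gt0// ltr_wpDl.
near=> n => x xd.
have n0 : (0 < n)%N by near: n; exact: nbhs_infty_gt.
have un := u_gt0 n0.
have E0 := enorm_ge0 x.
have Hn : \sum_(i < p) \sum_(j < p) `|(H n - H0) i j| <= l / 4.
  apply/ltW; near: n.
  have /cvgrPdist_lt/(_ (l / 4) (divr_gt0 l0 (ltr0Sn _ _))) := cvg_sum_norm_mx HP.
  apply: filterS => n; rewrite distrC subr0; apply: le_lt_trans; exact: ler_norm.
have cn : \sum_(i < p) `|c n ord0 i| <= 1.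
  apply/ltW; near: n.
  have /cvgrPdist_lt/(_ 1 ltr01) := cvg_sum_norm_mx cP.
  apply: filterS => n; rewrite distrC subr0 => /(le_lt_trans (ler_norm _)).
  by rewrite big_ord1; under eq_bigr do rewrite subr0.
have dn : d n <= D by near: n.
have tn : `|theta0 - theta n| < rho / 2.
  by near: n; have /cvgrPdist_lt/(_ (rho / 2)) := thetaP; apply; rewrite divr_gt0.
have pin : pi0 (rescale n x) <= pi0 theta0 + 1.
  (* Half of [rho] pays for theta_n - theta_0, the other half for x / sqrt n, whose sup norm is at
     most its Euclidean norm. *)
  have : ball theta0 rho (rescale n x).
    rewrite -ball_normE /= /rescale opprD addrA.
    rewrite (le_lt_trans (ler_normB _ _))// [ltRHS]splitr ltr_leD//.
    apply: le_trans d2; apply: norm_rV_le; first exact: ltW.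
    move=> i; rewrite mxE normrM gtr0_norm ?invr_gt0// ler_pdivrMl// mulrC.
    by apply: ltW; apply: le_lt_trans xd; exact: le_coord_enorm.
  by move=> /rhoP; rewrite distrC => /(le_lt_trans (ler_norm _)); rewrite ltrBlDl => /ltW.
rewrite /tilted -mulrA -expRD [leRHS]mulrC; apply: ler_pM; rewrite ?expR_ge0//.
rewrite log_ratio// ler_expR.
have qn : 3 / 4 * l * enorm x ^+ 2 <= qform (H n) x.
  have h1 : `|qform (H n - H0) x| <= l / 4 * enorm x ^+ 2.
    by apply: le_trans (qform_le_enorm _ _) _; rewrite ler_wpM2r// sqr_ge0.
  move: h1; rewrite qformB ler_norml => /andP[h1 _]; exact: form_bound (lE x) h1.
have rn : r n (rescale n x) - r n (theta n) <= c0 * enorm x ^+ 3 / u n + dotv x (c n) + d n.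
  apply: rle; apply: lt_trans xd _; rewrite ltr_pM2r//.
  by rewrite (le_lt_trans d1)// ltr_pdivrMr// ltr_pMr// ltr1n.
have r3 : c0 * enorm x ^+ 3 / u n <= l / 8 * enorm x ^+ 2.
  apply: (@le_trans _ _ (c0 * delta * enorm x ^+ 2)); last first.
    by rewrite ler_wpM2r// sqr_ge0.
  rewrite ler_pdivrMr// exprS.
  have -> : c0 * delta * enorm x ^+ 2 * u n = c0 * (delta * u n * enorm x ^+ 2) by ring.
  by rewrite ler_wpM2l// ler_wpM2r ?sqr_ge0// ltW.
have rc : dotv x (c n) <= enorm x.
  by apply: le_trans (dotv_le_enorm _ _) _; rewrite -[leRHS]mul1r ler_wpM2r.
(* AM-GM absorbs the linear term into the quadratic one *)
have amgm : enorm x <= l / 8 * enorm x ^+ 2 + 2 / l.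
  rewrite -subr_ge0 (_ : _ - _ = l / 8 * (enorm x - 4 / l) ^+ 2).
    by rewrite mulr_ge0 ?sqr_ge0// divr_ge0// ltW.
  by field; rewrite gt_eqF.
rewrite qform_scalar.
exact: exponent_bound qn rn r3 rc amgm dn.
Unshelve. all: by end_near. Qed.

Lemma tilted_cvg x :
  (fun n => tilted n x) @ \oo --> pi0 theta0 * expR (- (qform H0 x) / 2).
Proof.
rewrite mulrC; apply: cvgM.
  apply: (@continuous_cvg _ _ _ _ _ _ expR); first exact: continuous_expR.
  (* The formula for the exponent needs n > 0, so it replaces the log ratio only eventually. *)
  have e : \forall n \near \oo, - qform (H n) x / 2 + (r n (rescale n x) - r n (theta n)) =
      f n (rescale n x) - f n (theta n).
    by near=> n; rewrite log_ratio//; near: n; exact: nbhs_infty_gt.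
  suff : (fun n => - qform (H n) x / 2 + (r n (rescale n x) - r n (theta n))) @ \oo -->
      - qform H0 x / 2 by apply: cvg_trans; exact: near_eq_cvg e.
  rewrite -[X in _ --> X]addr0; apply: cvgD; last exact: r0.
  apply: cvgMr_tmp; apply: cvgN.
  apply/subr_cvg0/norm_cvg0P.
  have h := cvg_sum_norm_mx HP.
  apply: (@squeeze_cvgr _ _ _ _ (fun=> 0)
    (fun n => (\sum_(i < p) \sum_(j < p) `|(H n - H0) i j|) * enorm x ^+ 2)).
  - by apply: nearW => n; rewrite normr_ge0 /= -qformB qform_le_enorm.
  - exact: cvg_cst.
  - by rewrite -[X in _ --> X](mul0r (enorm x ^+ 2)); apply: cvgMr_tmp.
apply: (@continuous_cvg _ _ _ _ _ _ pi0 theta0) => //.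
rewrite -[X in _ --> X]addr0; apply: cvgD => //.
rewrite -(scale0r x); apply: cvgZr_tmp.
rewrite (_ : (fun n => _) = (fun n : nat => Num.sqrt (n%:R^-1 : R))); last first.
  by apply/funext => n; rewrite sqrtrV.
rewrite -(@sqrtr0 R); apply: (@continuous_cvg _ _ _ _ _ _ Num.sqrt); first exact: sqrt_continuous.
apply/gtr0_cvgV0; last exact: cvgr_idn.
by near=> n; rewrite ltr0n; near: n; exact: nbhs_infty_gt.
Unshelve. all: by end_near. Qed.

(** The condition on x says that t is at distance at least [delta] from theta_n, where (C2) applies.
    The factor [pi0] is kept because it supplies integrability. *)
Lemma tilted_outer_bound delta : 0 < delta < eps0 ->
  exists2 eta : R, 0 < eta & \forall n \near \oo, forall x, delta * u n <= enorm x ->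
    tilted n x <= expR (- (eta * n%:R)) * pi0 (rescale n x).
Proof.
move=> /[dup] /andP[d0 _] /C2 /limn_einf_near_ge[eta eta0 he]; exists eta => //.
near=> n => x xd.
have n0 : (0 < n)%N by near: n; exact: nbhs_infty_gt.
have un := u_gt0 n0.
have : (eta%:E <= ((f n (theta n) - f n (rescale n x)) / n%:R)%:E)%E.
  have : (eta%:E <= ereal_inf [set ((f n (theta n) - f n t) / n%:R)%:E
          | t in [set t : 'rV[R]_p | (delta <= enorm (t - theta n))%R]])%E by near: n.
  move=> /le_trans; apply; apply: ereal_inf_lbound; exists (rescale n x) => //=.
  by rewrite /rescale addrAC subrr add0r enormZ gtr0_norm ?invr_gt0// mulrC ler_pdivlMr.
rewrite lee_fin ler_pdivlMr ?ltr0n// => h.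
by rewrite ler_wpM2r// ler_expR; lra.
Unshelve. all: by end_near. Qed.

Context (fmeas : forall n, rV_measurable_fun (f n)) (pmeas : prob_density pi0).

Lemma rV_measurable_funE q (h : 'rV[R]_q -> R) :
  rV_measurable_fun h -> measurable_fun [set: rVb R q] h.
Proof. by move=> mh _ Y mY; rewrite setTI; exact: mh. Qed.

Let mpi : measurable_fun [set: rVb R p] pi0 := rV_measurable_funE pmeas.1.

Lemma measurable_tilted n : measurable_fun [set: rVb R p] (tilted n).
Proof.
have maff := measurable_affine_rV (theta n) (u n)^-1.
apply: measurable_funM; last exact: (measurableT_comp mpi maff).
apply: measurableT_comp => //; apply: measurable_funB => //.
exact: (measurableT_comp (rV_measurable_funE (@fmeas n)) maff).
Qed.

Lemma integral_rescale n (h : 'rV[R]_p -> R) : (0 < n)%N ->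
  measurable_fun [set: rVb R p] h -> (forall t, 0 <= h t) ->
  (\int[lebesgue_rV p]_x (h (rescale n x))%:E =
   (u n ^+ p)%:E * \int[lebesgue_rV p]_t (h t)%:E)%E.
Proof.
move=> n0 mh h0; have un := u_gt0 n0.
have mhE : measurable_fun [set: rVb R p] (fun x => (h x)%:E) by exact/measurable_EFinP.
have iun : 0 < (u n)^-1 by rewrite invr_gt0.
have hE0 t : (0 <= (h t)%:E)%E by rewrite lee_fin.
rewrite -(integral_lebesgue_rV_affine (theta n) iun mhE hE0).
by rewrite muleA -EFinM -exprMn mulfV ?gt_eqF// expr1n mul1e.
Qed.

Let limit (x : 'rV[R]_p) := pi0 theta0 * expR (- (qform H0 x) / 2).

Let mlimit : measurable_fun [set: rVb R p] limit.
Proof. by apply: measurable_funM => //; apply/measurable_EFinP; exact: measurable_gauss_rV. Qed.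

Let limit_ge0 x : 0 <= limit x. Proof. by rewrite mulr_ge0// expR_ge0. Qed.

Lemma tilted_L1_cvg :
  (fun n => \int[lebesgue_rV p]_x (`|tilted n x - limit x|)%:E)%E @ \oo --> 0%E.
Proof.
have [delta [lam [K [/andP[d0 de] l0 K0 [N _ inner]]]]] := tilted_inner_bound.
have dd : 0 < delta < eps0 by rewrite d0.
have [eta eta0 outer] := tilted_outer_bound dd.
pose A n : set (rVb R p) := [set x | enorm (x : 'rV[R]_p) < delta * u n].
have mA n : measurable (A n).
  rewrite (_ : A n = @enorm R p @^-1` `]-oo, delta * u n[%classic); last first.
    by apply/seteqP; split => x /=; rewrite in_itv.
  rewrite -[X in measurable X]setTI; apply: continuous_measurable_rVR => //.
  exact: enorm_continuous.
(* Truncation to the inner region: dominated convergence applies to [h], and the outer part of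
   [tilted] is estimated separately. *)
pose h n x : R := tilted n x * \1_(A n) x.
have mh n : measurable_fun [set: rVb R p] (h n).
  by apply: measurable_funM; [exact: measurable_tilted|exact: measurable_indic].
have h0 n x : 0 <= h n x by rewrite mulr_ge0// tilted_ge0.
pose G (x : 'rV[R]_p) : R := K * expR (- (qform lam%:M x) / 2).
have lampos : posdef_mx (lam%:M : 'M[R]_p) by exact: posdef_scalar.
have mG0 := measurable_gauss_rV (lam%:M : 'M[R]_p).
have mG : measurable_fun [set: rVb R p] (EFin \o G).
  by apply/measurable_EFinP; apply: measurable_funM => //; exact/measurable_EFinP.
have G0 x : 0 <= G x by rewrite mulr_ge0 ?expR_ge0// ltW.
have iG : (lebesgue_rV p).-integrable setT (EFin \o G).
  apply/integrableP; split => //.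
  under eq_integral => x _ do rewrite /= ger0_norm// EFinM.
  rewrite ge0_integralZl ?lee_fin ?(ltW K0)//.
  by rewrite (integral_gauss_rV lampos).2 -EFinM ltry.
have hG n x : (N <= n)%N -> h n x <= G x.
  move=> Nn; rewrite /h indicE; case: (boolP (x \in A n)) => [|_]; last by rewrite mulr0.
  by rewrite inE mulr1 => xA; exact: inner.
have hcvg x : (fun n => h n x) @ \oo --> limit x.
  (* A fixed x lies in [A n] as soon as n exceeds (|x| / delta)^2, so truncation does not alter the
     pointwise limit. *)
  have e : \forall n \near \oo, tilted n x = h n x.
    near=> n; rewrite /h indicE mem_set ?mulr1// /A /=.
    rewrite mulrC -ltr_pdivrMr//.
    have E0 : 0 <= enorm x / delta by rewrite divr_ge0 ?enorm_ge0// ltW.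
    rewrite -(ger0_norm E0) -sqrtr_sqr ltr_sqrt ?ltr0n; last by near: n; exact: nbhs_infty_gt.
    by near: n; exact: nbhs_infty_gtr.
  by move: (@tilted_cvg x); apply: cvg_trans; exact: near_eq_cvg e.
have h_limit : (fun n => \int[lebesgue_rV p]_x (`|h n x - limit x|)%:E)%E @ \oo --> 0%E.
  (* The Gaussian domination holds only from [N] on, hence the shifted sequence. *)
  rewrite -(cvg_shiftn N).
  have [|||||_ + _] := @dominated_convergence _ _ _ (lebesgue_rV p) setT measurableT
    (fun n x => (h (n + N)%N x)%:E) (EFin \o limit) (EFin \o G).
  - by move=> n; apply/measurable_EFinP; exact: mh.
  - by apply/measurable_EFinP; exact: mlimit.
  - apply: aeW => x _; apply/cvg_EFin; first exact: nearW.
    by move: (@hcvg x); rewrite -(cvg_shiftn N).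
  - exact: iG.
  - by apply: aeW => x n _; rewrite /= lee_fin ger0_norm// hG// leq_addl.
  by [].
have sum_limit : (fun n => \int[lebesgue_rV p]_x (`|h n x - limit x|)%:E +
    (u n ^+ p * expR (- (eta * n%:R)))%:E)%E @ \oo --> 0%E.
  rewrite -[X in _ --> X](adde0 0%E); apply: cvgeD => //.
  apply/cvg_EFin; first exact: nearW.
  exact: cvg_sqrtn_expR0.
apply: squeeze_cvge (cvg_cst 0%E) sum_limit.
near=> n; rewrite integral_ge0/=; last by move=> x _; rewrite lee_fin.
have n0 : (0 < n)%N by near: n; exact: nbhs_infty_gt.
pose k x := expR (- (eta * n%:R)) * pi0 (rescale n x).
have mres : measurable_fun [set: rVb R p] (fun x => pi0 (rescale n x)).
  exact: (measurableT_comp mpi (measurable_affine_rV (theta n) (u n)^-1)).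
have mk : measurable_fun [set: rVb R p] (fun x => (k x)%:E).
  by apply/measurable_EFinP; exact: measurable_funM.
have k0 x : 0 <= k x by rewrite mulr_ge0 ?expR_ge0.
(* The density has total mass 1, so only the Jacobian sqrt n ^ p and the exponential factor
   remain. *)
have kE : (\int[lebesgue_rV p]_x (k x)%:E = (u n ^+ p * expR (- (eta * n%:R)))%:E)%E.
  under eq_integral do rewrite EFinM.
  have mresE : measurable_fun [set: rVb R p] (fun x => (pi0 (rescale n x))%:E).
    exact/measurable_EFinP.
  rewrite (ge0_integralZl _ _ mresE) ?lee_fin ?expR_ge0//.
  rewrite integral_rescale//.
  rewrite -iint_integral ?pmeas.2.2 ?mule1 -?EFinM.
  - by rewrite mulrC.
  - exact/measurable_EFinP.
  - by move=> x; rewrite lee_fin.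
  - by move=> x _; rewrite lee_fin.
have mdist (g : 'rV[R]_p -> R) : measurable_fun [set: rVb R p] g ->
    measurable_fun [set: rVb R p] (fun x => (`|g x - limit x|)%:E).
  by move=> mg; apply/measurable_EFinP; apply: measurableT_comp => //; exact: measurable_funB.
have outn : forall x, delta * u n <= enorm x ->
    tilted n x <= expR (- (eta * n%:R)) * pi0 (rescale n x) by near: n.
rewrite -kE -(ge0_integralD _ measurableT _ (mdist _ (mh n)) _ mk); last 2 first.
- by move=> x _; rewrite lee_fin.
- by move=> x _; rewrite lee_fin.
apply: ge0_le_integral => //.
- exact: mdist (measurable_tilted n).
- by apply: emeasurable_funD => //; exact: mdist (mh n).
move=> x _; rewrite -EFinD lee_fin /h indicE.
(* Inside [A n] the truncation is exact. Outside, [h] vanishes, and the distance of [tilted] to the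
   limit is at most the limit plus [k]. *)
have [xA|] := boolP (x \in A n); first by rewrite mulr1 lerDl.
rewrite notin_setE /A /= => /negP; rewrite -leNgt => /outn tk.
rewrite mulr0 sub0r normrN (ger0_norm (limit_ge0 x)) [leRHS]addrC.
rewrite (le_trans (ler_normB _ _))// (ger0_norm (tilted_ge0 n x)).
by rewrite (ger0_norm (limit_ge0 x)) lerD2r.
Unshelve. all: by end_near. Qed.

Lemma normalized_L1_cvg : 0 < pi0 theta0 ->
  (forall n, (iint (fun t => (expR (f n t) * pi0 t)%:E) < +oo)%E) ->
  (fun n => iint (fun x => (`| (u n ^+ p)^-1 *
      (expR (f n (rescale n x)) * pi0 (rescale n x) /
       fine (iint (fun t => (expR (f n t) * pi0 t)%:E))) -
      gauss_density H0 x |)%:E)) @ \oo --> 0%E.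
Proof.
move=> pi00 zfin; have [det0 gaussE] := integral_gauss_rV H0pos.
have mf n : measurable_fun [set: rVb R p] (f n) := rV_measurable_funE (@fmeas n).
pose F n (t : 'rV[R]_p) := expR (f n t) * pi0 t.
have F0 n t : 0 <= F n t by rewrite mulr_ge0// expR_ge0.
have mF n : measurable_fun [set: rVb R p] (F n).
  by apply: measurable_funM => //; exact: measurableT_comp.
pose z n := fine (iint (fun t => (F n t)%:E)).
have zE n : (\int[lebesgue_rV p]_t (F n t)%:E = (z n)%:E)%E.
  rewrite -iint_integral; first last.
  - by move=> t; rewrite lee_fin.
  - exact/measurable_EFinP.
  rewrite /z fineK// ge0_fin_numE; first exact: zfin.
  rewrite iint_integral; first last.
  - by move=> t; rewrite lee_fin.
  - exact/measurable_EFinP.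
  by apply: integral_ge0 => t _; rewrite lee_fin.
pose Z := pi0 theta0 * (Num.sqrt (2 * pi) ^+ p / Num.sqrt (\det H0)).
have s2pi : 0 < Num.sqrt (2 * pi) :> R by rewrite sqrtr_gt0 mulr_gt0// pi_gt0.
have sdet : 0 < Num.sqrt (\det H0) by rewrite sqrtr_gt0.
have Z0 : 0 < Z by rewrite mulr_gt0// divr_gt0// exprn_gt0.
have ZE : (\int[lebesgue_rV p]_x (limit x)%:E = Z%:E)%E.
  under eq_integral do rewrite EFinM.
  rewrite ge0_integralZl ?lee_fin ?pi0_ge0//; first by rewrite gaussE.
  exact: measurable_gauss_rV.
(* The total mass of [tilted n] for n > 0: dividing by it cancels exp (- f_n theta_n) and leaves the
   rescaled posterior density. *)
pose Y n := expR (- f n (theta n)) * (u n ^+ p * z n).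
have tiltedE n x : tilted n x = expR (- f n (theta n)) * F n (rescale n x).
  by rewrite /tilted /F mulrA -expRD addrC.
have YE n : (0 < n)%N -> (\int[lebesgue_rV p]_x (tilted n x)%:E = (Y n)%:E)%E.
  move=> n0; under eq_integral do rewrite tiltedE EFinM.
  have mres : measurable_fun [set: rVb R p] (fun x => (F n (rescale n x))%:E).
    apply/measurable_EFinP.
    exact: (measurableT_comp (mF n) (measurable_affine_rV (theta n) (u n)^-1)).
  rewrite (ge0_integralZl _ _ mres) ?lee_fin ?expR_ge0//.
    by rewrite integral_rescale// zE -!EFinM.
  by move=> x _; rewrite lee_fin.
have gaussZ x : gauss_density H0 x = limit x / Z.
  rewrite /gauss_density /limit /Z; field.
  by rewrite !gt_eqF// exprn_gt0.
have qY m x : (0 < m)%N -> (u m ^+ p)^-1 * (F m (rescale m x) / z m) = tilted m x / Y m.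
  move=> m0; rewrite tiltedE /Y !invfM; set e := expR _.
  have -> : e * F m (rescale m x) * (e^-1 * ((u m ^+ p)^-1 / z m)) =
    (e * e^-1) * ((u m ^+ p)^-1 * (F m (rescale m x) / z m)) by ring.
  by rewrite mulfV ?mul1r// gt_eqF// expR_gt0.
have bound : (fun n => (2 / Z)%:E * \int[lebesgue_rV p]_x (`|tilted n x - limit x|)%:E)%E
    @ \oo --> 0%E.
  rewrite -[X in _ --> X](mule0 (2 / Z)%:E); apply: cvgeZl => //.
  exact: tilted_L1_cvg.
apply: squeeze_cvge (cvg_cst 0%E) bound.
near=> n; have n0 : (0 < n)%N by near: n; exact: nbhs_infty_gt.
have mT := measurable_tilted n.
have -> : iint (fun x => (`| (u n ^+ p)^-1 * (F n (rescale n x) / z n) -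
      gauss_density H0 x |)%:E) =
    (\int[lebesgue_rV p]_x (`|tilted n x / Y n - limit x / Z|)%:E)%E.
  rewrite -iint_integral; first last.
  - by move=> x; rewrite lee_fin.
  - apply/measurable_EFinP; apply: measurableT_comp => //.
    by apply: measurable_funB; apply: measurable_funM.
  by congr iint; apply/funext => x; rewrite qY// gaussZ.
rewrite integral_ge0/=; last by move=> x _; rewrite lee_fin.
by apply: integral_normalized_dist => //; [exact: tilted_ge0|exact: YE].
Unshelve. all: by end_near. Qed.

End rescaled_posterior.

Theorem mainTheorem3 (R : realType) (p : nat)
  (pi0 : 'rV[R]_p -> R) (theta0 : 'rV[R]_p)
  (f : nat -> 'rV[R]_p -> R) (theta : nat -> 'rV[R]_p) :
  prob_density pi0 ->
  {for theta0, continuous pi0} ->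
  0 < pi0 theta0 ->
  (forall n, rV_measurable_fun (f n)) ->
  (forall n, (iint (fun t => (expR (f n t) * pi0 t)%:E) < +oo)%E) ->
  theta @ \oo --> theta0 ->
  let z := fun n => fine (iint (fun t => (expR (f n t) * pi0 t)%:E)) in
  let pin := fun n t => expR (f n t) * pi0 t / z n in
  let q := fun n (x : 'rV[R]_p) =>
    ((Num.sqrt n%:R) ^+ p)^-1 * pin n (theta n + (Num.sqrt n%:R)^-1 *: x) in
  forall H0 : 'M[R]_p,
  (* (C1) and (C2) *)
  (exists (H : nat -> 'M[R]_p) (r : nat -> 'rV[R]_p -> R)
          (eps0 c0 : R) (c : nat -> 'rV[R]_p) (d : nat -> R),
      (forall n, symmetric_mx (H n)) /\
          H @ \oo --> H0 /\
          posdef_mx H0 /\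
          (forall n t, f n t = f n (theta n) - n%:R / 2 * qform (H n) (t - theta n)
                               + r n t) /\
          (forall x : 'rV[R]_p,
              (fun n => r n (theta n + (Num.sqrt n%:R)^-1 *: x) - r n (theta n))
                @ \oo --> 0) /\
          (0 < eps0 /\ 0 <= c0) /\
          c @ \oo --> (0 : 'rV[R]_p) /\
          (limn_esup (fun n => (d n)%:E) < +oo)%E /\
          (forall n (x : 'rV[R]_p), enorm x < eps0 * Num.sqrt n%:R ->
              r n (theta n + (Num.sqrt n%:R)^-1 *: x) - r n (theta n)
                <= c0 * enorm x ^+ 3 / Num.sqrt n%:R + dotv x (c n) + d n) /\
          (forall eps : R, 0 < eps < eps0 ->
              (0 < limn_einf (fun n =>
                  ereal_inf [set ((f n (theta n) - f n t) / n%:R)%:E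
                            | t in [set t : 'rV[R]_p | (eps <= enorm (t - theta n))%R]]))%E)) ->
  (fun n => iint (fun x => (`| q n x - gauss_density H0 x |)%:E)) @ \oo --> 0%E.
Proof.
move=> pd pc p0 mf zfin thetaP z pin q H0.
move=> [H [r [eps0 [c0 [c [d [_ [HP [Hpos [fE [r0 [[e0 c00] [cP [dP [rle C2]]]]]]]]]]]]]]].
exact: (normalized_L1_cvg pd.2.1 pc thetaP HP Hpos fE r0 e0 c00 cP dP rle C2 mf pd p0 zfin).
Qed.
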